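(* For any injective endomorphism $\mathfrak{e}$ of the semigroup $\boldsymbol{B}_{\mathbb{Z}}^{\mathscr{F}^2}$ there exist an injective $(0,0,[0))$-endomorphism $\mathfrak{e}_0$ of $\boldsymbol{B}_{\mathbb{Z}}^{\mathscr{F}^2}$ and an automorphism $\mathfrak{a}$ of $\boldsymbol{B}_{\mathbb{Z}}^{\mathscr{F}^2}$ such that $\mathfrak{e}=\mathfrak{e}_0\mathfrak{a}$. Moreover, $\mathfrak{e}=\mathfrak{e}_0\widetilde{\mathfrak{a}}^{2s}=\mathfrak{e}_0\mathfrak{h}_s$ in the case when $(0,0,[0))\mathfrak{e}=(s,s,[0))$ for some integer $s$; $\mathfrak{e}=\mathfrak{e}_0\widetilde{\mathfrak{a}}^{2s+1}=\mathfrak{e}_0\mathfrak{h}_s\widetilde{\mathfrak{a}}$ in the case when $(0,0,[0))\mathfrak{e}=(s,s,[1))$ for some integer $s$; and one of the following conditions holds: (1) there exist a positive integer $k$ and $p\in\{0,\ldots,k-1\}$ such that $\mathfrak{e}_0=\alpha_{k,p}$; (2) there exist a positive integer $k\geqslant 2$ and $p\in\{1,\ldots,k-1\}$ such that $\mathfrak{e}_0=\beta_{k,p}$.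
   Context: Let $\omega$ be the set of non-negative integers, and $[a)=\{x\in\omega\colon x\geqslant a\}$ for $a\in\omega$. A subset $A\subseteq\omega$ is inductive if $i\in A$ implies $i+1\in A$. For an integer $m$ and $F\subseteq\omega$ put $m+F=\{m+x\colon x\in F\}\subseteq\mathbb{Z}$. A family $\mathscr{F}$ of subsets of $\omega$ is $\omega$-closed if $F_1\cap(-n+F_2)\in\mathscr{F}$ for all $n\in\omega$ and $F_1,F_2\in\mathscr{F}$. Throughout, $\mathscr{F}^2$ is an $\omega$-closed family consisting of exactly two inductive nonempty subsets of $\omega$ with $[0)\in\mathscr{F}^2$; equivalently, $\mathscr{F}^2=\{[0),[1)\}$. The semigroup $\boldsymbol{B}_{\mathbb{Z}}^{\mathscr{F}^2}$ is the set $\mathbb{Z}\times\mathbb{Z}\times\mathscr{F}^2$ with the operation $$(i_1,j_1,F_1)\cdot(i_2,j_2,F_2)=\begin{cases}(i_1-j_1+i_2,\,j_2,\,(j_1-i_2+F_1)\cap F_2), & j_1\leqslant i_2;\\ (i_1,\,j_1-i_2+j_2,\,F_1\cap(i_2-j_1+F_2)), & j_1\geqslant i_2.\end{cases}$$ Maps are written on the right of their arguments and composed from left to right. A $(0,0,[0))$-endomorphism is an endomorphism $\mathfrak{e}$ of $\boldsymbol{B}_{\mathbb{Z}}^{\mathscr{F}^2}$ with $(0,0,[0))\mathfrak{e}=(0,0,[0))$. For $s\in\mathbb{Z}$, $\mathfrak{h}_s$ is the automorphism $(i,j,[q))\mapsto(i+s,j+s,[q))$, and $\widetilde{\mathfrak{a}}$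 is the automorphism $(i,j,[q))\mapsto(i+q,j+q,[1-q))$, where $i,j\in\mathbb{Z}$, $q\in\{0,1\}$ (both are known to be automorphisms of $\boldsymbol{B}_{\mathbb{Z}}^{\mathscr{F}^2}$, with $\widetilde{\mathfrak{a}}^2=\mathfrak{h}_1$). For a positive integer $k$ and $p\in\{0,\ldots,k-1\}$, $\alpha_{k,p}$ is the self-map of $\boldsymbol{B}_{\mathbb{Z}}^{\mathscr{F}^2}$ given, for all $i,j\in\mathbb{Z}$, by $(i,j,[0))\alpha_{k,p}=(ki,kj,[0))$ and $(i,j,[1))\alpha_{k,p}=(p+ki,p+kj,[1))$. For a positive integer $k\geqslant2$ and $p\in\{1,\ldots,k-1\}$, $\beta_{k,p}$ is the self-map given, for all $i,j\in\mathbb{Z}$, by $(i,j,[0))\beta_{k,p}=(ki,kj,[0))$ and $(i,j,[1))\beta_{k,p}=(p+ki,p+kj,[0))$. *)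

(* Defs.v *)
From HB Require Import structures.
From mathcomp Require Import all_boot all_order all_algebra.
From mathcomp Require Import zify.
From mathcomp Require Import boolp classical_sets functions cardinality.

Set Implicit Arguments.
Unset Strict Implicit.
Unset Printing Implicit Defensive.

Import Order.TTheory GRing.Theory Num.Theory.

Local Open Scope classical_set_scope.
Local Open Scope ring_scope.

(* The ray [a) = {x \in omega | x >= a} *)
Definition ray (a : nat) : set nat := [set x | (a <= x)%N].

Definition inductive_set (A : set nat) : Prop := forall i, A i -> A i.+1.

(* m + F, a subset of Z *)
Definition shift (m : int) (F : set nat) : set int := [set m + x%:Z | x in F].

(* A subset G of Z is intersected with a subset F of omega by means of the
   inclusion Posz of omega in Z, so that the result is a subset of omega. *)
Definition cap_shift (F1 : set nat) (m : int) (F2 : set nat) : set nat :=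
  F1 `&` Posz @^-1` shift m F2.

Definition omega_closed (Fam : set (set nat)) : Prop :=
  forall (n : nat) (F1 F2 : set nat),
    Fam F1 -> Fam F2 -> Fam (cap_shift F1 (- n%:Z) F2).

Record family2 := Family2 {
  fam2 :> set (set nat);
  fam2_closed : omega_closed fam2;
  fam2_card : (fam2 #= `I_2)%card;
  fam2_inductive : forall F, fam2 F -> inductive_set F;
  fam2_nonempty : forall F, fam2 F -> F !=set0;
  fam2_ray0 : fam2 (ray 0)
}.

Lemma cap_shiftE (a b : nat) (m : int) x :
  cap_shift (ray a) m (ray b) x <-> (a <= x)%N /\ (m + b%:Z <= x%:Z).
Proof.
rewrite /cap_shift /shift /ray /=; split=> [[ax [y /= by_ xy]]|[ax bx]].
  by split=> //; lia.
split=> //; exists `|x%:Z - m|%N => /=; lia.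
Qed.

Lemma cap_shift_ray (a b c : nat) (m : int) :
  (forall x : nat, (c <= x)%N = (a <= x)%N && (m + b%:Z <= x%:Z)) ->
  cap_shift (ray a) m (ray b) = ray c.
Proof.
move=> h; apply/seteqP; split=> x; rewrite cap_shiftE.
  by move=> [ax bx]; rewrite /ray /= h ax.
by rewrite /ray /= h => /andP.
Qed.

Lemma inductive_ray (A : set nat) :
  inductive_set A -> A !=set0 -> exists a, A = ray a.
Proof.
move=> indA [x0 Ax0].
have exA : exists n, `[< A n >] by exists x0; apply/asboolP.
exists (ex_minn exA); case: ex_minnP => m /asboolP Am min.
apply/seteqP; split=> x; first by move=> Ax; apply: min; apply/asboolP.
rewrite /ray /= => /subnK <-; elim: (x - m)%N => [|k IH] //.
by rewrite addSn; apply: indA.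
Qed.

Lemma ray_inj : injective ray.
Proof.
move=> a b e.
have : ray b a by rewrite -e /ray /=.
have : ray a b by rewrite e /ray /=.
by rewrite /ray /= => ab ba; apply/eqP; rewrite eqn_leq ab ba.
Qed.

Lemma fam2E (Fam : family2) : (Fam : set (set nat)) = [set ray 0; ray 1].
Proof.
have F0 := fam2_ray0 Fam.
have /eq_cardSP[A FA /eq_cardSP[C [FC neCA] D0]] := fam2_card Fam.
have two D : fam2 Fam D -> D = A \/ D = C.
  move=> FD; have [DA|DA] := pselect (D = A); first by left.
  have [DC|DC] := pselect (D = C); first by right.
  have : (fam2 Fam `\ A `\ C) D by split=> //; split.
  by move: D0; rewrite II0 card_eq0 => /eqP ->.
have [D [FD D0']] : exists D, fam2 Fam D /\ D <> ray 0.
  have [AE|nA] := pselect (A = ray 0); last by exists A.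
  by exists C; split=> //; rewrite -AE => CA; apply: neCA.
have [n nE] := inductive_ray (fam2_inductive FD) (fam2_nonempty FD).
have n_gt0 : (0 < n)%N by case: n nE => // DE; case: D0'.
have only G : fam2 Fam G -> G = ray 0 \/ G = D.
  move=> /two GG; have := two _ F0; have := two _ FD => DD RR.
  by move: GG DD RR D0' neCA => [] -> [] -> [] ->; tauto.
have /only[e|e] : fam2 Fam (ray n.-1).
  have := fam2_closed (1%N) F0 FD; rewrite nE.
  rewrite (@cap_shift_ray _ _ n.-1) // => x; lia.
- have n1 : n = 1%N by move/ray_inj: e; lia.
  apply/seteqP; split=> G; last by case=> ->; rewrite -?n1 -?nE.
  by move=> /only; rewrite nE n1.
- by move: e; rewrite nE => /ray_inj; lia.
Qed.

(* Conversely, {[0), [1)} is such a family, so that family2 is inhabited. *)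
Lemma omega_closed01 : omega_closed [set ray 0; ray 1].
Proof.
move=> n F1 F2 [->|->] [->|->].
- by left; apply: cap_shift_ray => x; lia.
- case: n => [|n]; first by right; apply: cap_shift_ray => x; lia.
  by left; apply: cap_shift_ray => x; lia.
- by right; apply: cap_shift_ray => x; lia.
- by right; apply: cap_shift_ray => x; lia.
Qed.

Lemma card01 : ([set ray 0; ray 1] #= `I_2)%card.
Proof.
apply/eq_cardSP; exists (ray 0); first by left.
apply/eq_cardSP; exists (ray 1).
  by split; [right|move=> /ray_inj].
rewrite II0 card_eq0; apply/eqP/seteqP; split=> // G [[h n0] n1].
by case: h => [/n0|/n1].
Qed.

Lemma ray_inductive a : inductive_set (ray a).
Proof. by move=> i; rewrite /ray /=; apply: leqW. Qed.

Lemma ray_nonempty a : ray a !=set0.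
Proof. by exists a; rewrite /ray /=. Qed.

Definition family01 : family2.
Proof.
refine (@Family2 [set ray 0; ray 1] omega_closed01 card01 _ _ _).
- by move=> F [->|->]; exact: ray_inductive.
- by move=> F [->|->]; exact: ray_nonempty.
- by left.
Defined.

Lemma fam2_ray (Fam : family2) (q : bool) : ray q \in (Fam : set (set nat)).
Proof. by rewrite inE fam2E; case: q; [right|left]. Qed.

(* [q) as an element of the family, for q in {0, 1} encoded as a boolean *)
Definition fray (Fam : family2) (q : bool) : Fam := exist _ (ray q) (fam2_ray Fam q).
Arguments fray {Fam} q.

(* The q in {0, 1} such that F = [q) *)
Definition level (Fam : family2) (F : Fam) : bool := 0%N \notin val F.

Lemma frayK (Fam : family2) : cancel (@fray Fam) (@level Fam).
Proof.
case; rewrite /level /=; first by apply/negP; rewrite inE.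
by apply/negP; apply; rewrite inE.
Qed.

Lemma levelK (Fam : family2) : cancel (@level Fam) (@fray Fam).
Proof.
move=> F; have [q ->] : exists q, F = fray q; last by rewrite frayK.
have : [set ray 0; ray 1] (val F) by rewrite -(fam2E Fam); exact/set_mem/(valP F).
by case=> FE; [exists false|exists true]; exact: val_inj.
Qed.

Lemma fcap_subproof (Fam : family2) (F1 : Fam) (n : nat) (F2 : Fam) :
  cap_shift (val F1) (- n%:Z) (val F2) \in (Fam : set (set nat)).
Proof.
by apply/mem_set/fam2_closed; apply: set_mem; [exact: (valP F1)|exact: (valP F2)].
Qed.

(* The intersection of F1 and -n + F2 as an element of the family *)
Definition fcap (Fam : family2) (F1 : Fam) (n : nat) (F2 : Fam) : Fam :=
  exist _ (cap_shift (val F1) (- n%:Z) (val F2)) (fcap_subproof F1 n F2).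

Definition BZ (Fam : family2) : Type := (int * int * Fam)%type.

HB.instance Definition _ (Fam : family2) :=
  Choice.copy (BZ Fam) (int * int * Fam)%type.

(* In each branch the absolute value is the number itself: the set component is
   (j1 - i2 + F1) /\ F2 in the first one and F1 /\ (i2 - j1 + F2) in the second. *)
Definition BZmul (Fam : family2) (x y : BZ Fam) : BZ Fam :=
  let: (i1, j1, F1) := x in
  let: (i2, j2, F2) := y in
  if j1 <= i2 then (i1 - j1 + i2, j2, fcap F2 `|i2 - j1| F1)
  else (i1, j1 - i2 + j2, fcap F1 `|j1 - i2| F2).

(* The two cases of the definition agree on their overlap. *)
Lemma BZmul_ge (Fam : family2) (i1 j1 i2 j2 : int) (F1 F2 : Fam) :
  i2 <= j1 -> BZmul (i1, j1, F1) (i2, j2, F2) =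
              (i1, j1 - i2 + j2, fcap F1 `|j1 - i2| F2).
Proof.
rewrite /BZmul => le_ij; case: ifP => // le_ji.
have -> : j1 = i2 by lia.
congr (_, _, _); [lia|lia|].
rewrite -[F1]levelK -[F2]levelK; apply: val_inj.
by rewrite /= subrr; apply/seteqP; split=> x; rewrite !cap_shiftE; lia.
Qed.

Lemma fcap_fray (Fam : family2) (a b : bool) (n : nat) :
  fcap (@fray Fam a) n (fray b) = fray (a || b && (n == 0)).
Proof.
apply: val_inj => /=; apply: cap_shift_ray => x; case: a; case: b; lia.
Qed.

Lemma BZmulE (Fam : family2) (i1 j1 i2 j2 : int) (a b : bool) :
  BZmul (i1, j1, @fray Fam a) (i2, j2, fray b) =
  (i1 - j1 + Num.max j1 i2, j2 - i2 + Num.max j1 i2,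
   fray (if j1 < i2 then b else if i2 < j1 then a else a || b)).
Proof.
rewrite /BZmul; have [h|h|<-] := ltgtP j1 i2; rewrite fcap_fray;
  congr (_, _, fray _); try lia; case: a; case: b; lia.
Qed.

Lemma BZmulA (Fam : family2) : associative (@BZmul Fam).
Proof.
move=> [[i1 j1] F1] [[i2 j2] F2] [[i3 j3] F3].
rewrite -[F1]levelK -[F2]levelK -[F3]levelK.
move: (level F1) (level F2) (level F3) => a b c.
rewrite !BZmulE; congr (_, _, fray _); [lia|lia|].
by move: a b c => [] [] []; repeat case: ifP; lia.
Qed.

HB.instance Definition _ (Fam : family2) :=
  isSemigroup.Build (BZ Fam) (@BZmulA Fam).

Lemma mulBZE (Fam : family2) (x y : BZ Fam) : (x * y)%g = BZmul x y.
Proof. by []. Qed.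

Record automorphism (S : magmaType) := Automorphism {
  aut_fun :> S -> S;
  aut_inv : S -> S;
  aut_morph : {morph aut_fun : x y / (x * y)%g};
  autK : cancel aut_fun aut_inv;
  autKV : cancel aut_inv aut_fun
}.

(* Integer powers a^n *)
Definition aut_exp (S : magmaType) (a : automorphism S) (n : int) : S -> S :=
  match n with
  | Posz m => iter m a
  | Negz m => iter m.+1 (aut_inv a)
  end.

Section Maps.
Variable Fam : family2.
Implicit Types (i j s : int) (k p : nat) (q : bool) (x : BZ Fam).

Definition h_fun s x : BZ Fam := let: (i, j, F) := x in (i + s, j + s, F).

Lemma h_morph s : {morph h_fun s : x y / (x * y)%g}.
Proof.
move=> [[i1 j1] F1] [[i2 j2] F2]; rewrite -[F1]levelK -[F2]levelK.
rewrite !mulBZE BZmulE /h_fun BZmulE; congr (_, _, fray _); try lia.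
by repeat case: ifP; lia.
Qed.

Lemma h_funK s : cancel (h_fun s) (h_fun (- s)).
Proof. by move=> [[i j] F] /=; rewrite !addrK. Qed.

Lemma h_funKV s : cancel (h_fun (- s)) (h_fun s).
Proof. by move=> [[i j] F] /=; rewrite !subrK. Qed.

Definition h_aut s : automorphism (BZ Fam) :=
  Automorphism (h_morph s) (h_funK s) (h_funKV s).

(* (i, j, [q)) |-> (i + q, j + q, [1 - q)) *)
Definition at_fun x : BZ Fam :=
  let: (i, j, F) := x in
  let q := level F in (i + q%:Z, j + q%:Z, fray (~~ q)).

Definition at_inv x : BZ Fam :=
  let: (i, j, F) := x in
  let q := ~~ level F in (i - q%:Z, j - q%:Z, fray q).

Lemma at_morph : {morph at_fun : x y / (x * y)%g}.
Proof.
move=> [[i1 j1] F1] [[i2 j2] F2]; rewrite -[F1]levelK -[F2]levelK.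
move: (level F1) (level F2) => a b.
rewrite !mulBZE BZmulE /at_fun !frayK BZmulE; congr (_, _, fray _);
  by move: a b => [] []; repeat case: ifP => //=; lia.
Qed.

Lemma at_funK : cancel at_fun at_inv.
Proof. by move=> [[i j] F] /=; rewrite frayK negbK levelK !addrK. Qed.

Lemma at_funKV : cancel at_inv at_fun.
Proof. by move=> [[i j] F] /=; rewrite frayK negbK levelK !subrK. Qed.

Definition at_aut : automorphism (BZ Fam) :=
  Automorphism at_morph at_funK at_funKV.

Lemma at_autE i j q :
  at_aut (i, j, fray q) = (i + q%:Z, j + q%:Z, fray (~~ q)).
Proof. by rewrite /= frayK. Qed.

Definition alpha k p x : BZ Fam :=
  let: (i, j, F) := x in
  if level F then (p%:Z + k%:Z * i, p%:Z + k%:Z * j, fray true)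
  else (k%:Z * i, k%:Z * j, fray false).

Lemma alphaE0 k p i j :
  alpha k p (i, j, fray false) = (k%:Z * i, k%:Z * j, fray false).
Proof. by rewrite /alpha frayK. Qed.

Lemma alphaE1 k p i j : alpha k p (i, j, fray true) =
  (p%:Z + k%:Z * i, p%:Z + k%:Z * j, fray true).
Proof. by rewrite /alpha frayK. Qed.

Definition beta k p x : BZ Fam :=
  let: (i, j, F) := x in
  if level F then (p%:Z + k%:Z * i, p%:Z + k%:Z * j, fray false)
  else (k%:Z * i, k%:Z * j, fray false).

Lemma betaE0 k p i j :
  beta k p (i, j, fray false) = (k%:Z * i, k%:Z * j, fray false).
Proof. by rewrite /beta frayK. Qed.

Lemma betaE1 k p i j : beta k p (i, j, fray true) =
  (p%:Z + k%:Z * i, p%:Z + k%:Z * j, fray false).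
Proof. by rewrite /beta frayK. Qed.

End Maps.
Arguments h_aut {Fam} s.
Arguments at_aut {Fam}.

(* Main.v *)
Require Import Defs.
From mathcomp Require Import all_boot all_order all_algebra.
From mathcomp Require Import boolp classical_sets functions cardinality.
From HB Require Import structures.
From mathcomp Require Import zify ring.

(** The idempotents of the semigroup are the triples (i, i, [q)), and the
    product of two of them is the one for which 2 i + q is larger: they form a
    chain isomorphic to Z.  Every element (i, j, [q)) has (j, i, [q)) as its
    unique inverse, so an endomorphism e is determined by its values on idempotents:
    there are functions f q and values r q with
      e (i, j, [q)) = (f q i, f q j, [r q))      ([endo_coordinates]).
    If e is injective, it is strictly increasing on the chain of idempotents
    ([endo_increasing]).  Multiplying (i + 1, i, [q)) by an idempotent
    (j, j, [q)) with i <= j gives (j + 1, j, [q)), whence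
    f q (i + 1) - f q i does not depend on i and f q is affine ([endo_affine]);
    f true and f false have the same slope k, because the chain interlaces the
    two levels ([endo_common_slope]).

    If moreover e fixes (0, 0, [0)), then f false i = k i, and with
    p = f true 0 the inequalities (0, 0, [0)) < (p, p, [r true)) < (k, k, [0))
    in the chain leave 0 <= p < k when r true = 1, which is alpha k p, and
    0 < p < k when r true = 0, which is beta k p ([endo_normal_form]).

    The general case reduces to this one, since some automorphism h_s or
    h_s at, according to the level of e (0, 0, [0)), moves (0, 0, [0)) to its
    image under e; composing e with the inverse of that automorphism gives e_0.
    That h_s and h_s at are the powers 2 s and 2 s + 1 of at follows from
    at^2 = h_1. *)

Set Implicit Arguments.
Unset Strict Implicit.
Unset Printing Implicit Defensive.

Import Order.TTheory GRing.Theory Num.Theory.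

Local Open Scope ring_scope.

Section Automorphisms.
Variable S : magmaType.
Implicit Types (a b : automorphism S) (x y : S).

Lemma aut_inv_morph a : {morph aut_inv a : x y / (x * y)%g}.
Proof. by move=> x y; apply: (can_inj (autK a)); rewrite aut_morph !autKV. Qed.

Lemma aut_comp_morph a b : {morph a \; b : x y / (x * y)%g}.
Proof. by move=> x y; rewrite /= !aut_morph. Qed.

Definition aut_comp a b : automorphism S :=
  Automorphism (aut_comp_morph a b) (can_comp (autK b) (autK a))
    (can_comp (autKV a) (autKV b)).

(** The e_0 of the factorization e = e_0 a. *)
Definition untwist a (e : {multiplicative S -> S}) x : S := aut_inv a (e x).

Lemma untwist_morph a e : {morph untwist a e : x y / (x * y)%g}.
Proof. by move=> x y; rewrite /untwist gmulfM aut_inv_morph. Qed.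

HB.instance Definition _ a e :=
  isMultiplicative.Build S S (untwist a e) (untwist_morph a e).

Lemma aut_expS a n x : aut_exp a (n + 1) x = a (aut_exp a n x).
Proof.
case: n => [n|[|n]]; first by rewrite -PoszD addn1.
  by rewrite /= autKV.
by rewrite (_ : Negz n.+1 + 1 = Negz n) ?[RHS]autKV //; lia.
Qed.

End Automorphisms.

Section Structure.
Variable Fam : family2.
Implicit Types (x y z : BZ Fam) (i j s : int) (q r : bool).

Local Notation pt i j q := ((i, j, @fray Fam q) : BZ Fam) (only parsing).

(** Every member of the family is [fray q], so an element may be written with
    an explicit level and [BZmulE] then computes products. *)
Lemma BZ_ind (P : BZ Fam -> Prop) :
  (forall i j q, P (i, j, fray q)) -> forall x, P x.
Proof. by move=> h [[i j] F]; rewrite -[F]levelK. Qed.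

Lemma triple_inj i j q i' j' q' :
  (i, j, @fray Fam q) = (i', j', fray q') -> [/\ i = i', j = j' & q = q'].
Proof. by case=> -> -> /ray_inj; case: q q' => [] []. Qed.

Lemma idempotent_diagonal x :
  (x * x)%g = x -> exists i q, x = (i, i, fray q).
Proof.
move: x; apply: BZ_ind => i j q; rewrite mulBZE BZmulE => /triple_inj[e1 e2 _].
by exists i, q; congr (_, _, _); lia.
Qed.

(** The first coordinates force the shape (j, i, [q')), and then both triple
    products have level q || q', which is thus equal to q and to q'. *)
Lemma inverse_unique i j q y :
  (pt i j q * y * pt i j q)%g = pt i j q ->
  (y * pt i j q * y)%g = y -> y = (j, i, fray q).
Proof.
move: y; apply: BZ_ind => i' j' q'.
rewrite !mulBZE !BZmulE => /triple_inj[e1 e2 e3] /triple_inj[e4 e5 e6].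
have ej : i' = j by lia.
have ei : j' = i by lia.
subst i' j'; congr (_, _, fray _).
by move: e3 e6; case: q q' => [] []; repeat case: ifP; lia.
Qed.

(** Inverses are preserved: the image of (j, i, [q)) is the inverse of the image
    (a, b, [c)) of (i, j, [q)), namely (b, a, [c)).  The two products of these
    images are then (a, a, [c)) and (b, b, [c)), but they are also the images of
    (i, i, [q)) and (j, j, [q)).  So the coordinates can be read off from the
    idempotents, and c depends on q only. *)
Lemma endo_coordinates (e : {multiplicative BZ Fam -> BZ Fam}) :
  exists (f : bool -> int -> int) (r : bool -> bool),
    forall i j q, e (i, j, fray q) = (f q i, f q j, fray (r q)).
Proof.
have E (i : int) q : exists jr : int * bool,
    e (i, i, fray q) = (jr.1, jr.1, fray jr.2).
  have [|j [r ->]] := @idempotent_diagonal (e (i, i, fray q)).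
    rewrite -gmulfM mulBZE BZmulE ltxx; congr (e (_, _, fray _)); lia.
  by exists (j, r).
have {E}[g gE] : exists g : bool -> int -> int * bool, forall q i,
    e (i, i, fray q) = ((g q i).1, (g q i).1, fray (g q i).2).
  have [g0 g0E] := choice (fun i => E i false).
  have [g1 g1E] := choice (fun i => E i true).
  by exists (fun q => if q then g1 else g0) => -[].
have mulD (i j k : int) q :
    (pt i j q * pt j k q)%g = (i, k, fray q) :> BZ Fam.
  rewrite mulBZE BZmulE ltxx orbb; congr (_, _, _); lia.
have main (i j : int) q :
    e (i, j, fray q) = ((g q i).1, (g q j).1, fray (g q i).2) /\
    (g q i).2 = (g q j).2.
  have : e (j, i, fray q) = (let: (a, b, F) := e (i, j, fray q) in (b, a, F)).
    have : (e (i, j, fray q) * e (j, i, fray q) * e (i, j, fray q))%g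
             = e (i, j, fray q) by rewrite -!gmulfM !mulD.
    have : (e (j, i, fray q) * e (i, j, fray q) * e (j, i, fray q))%g
             = e (j, i, fray q) by rewrite -!gmulfM !mulD.
    elim/BZ_ind: (e (i, j, fray q)) => a b r yxy xyx.
    exact: inverse_unique xyx yxy.
  have := gE q i; have := gE q j.
  rewrite -{1}(mulD i j i q) -{1}(mulD j i j q) !gmulfM.
  elim/BZ_ind: (e (i, j, fray q)) => a b r ej ei inv.
  move: ej ei; rewrite inv !mulBZE !BZmulE !ltxx !orbb.
  move=> /triple_inj[a1 _ <-] /triple_inj[b1 _ <-]; split=> //.
  by congr (_, _, _); lia.
exists (fun q i => (g q i).1), (fun q => (g q 0).2) => i j q.
by have [-> _] := main i j q; have [_ ->] := main i 0 q.
Qed.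

Lemma int_affine (f : int -> int) :
  (forall i j : int, i <= j -> f (i + 1) - f i = f (j + 1) - f j) ->
  forall i, f i = f 0 + (f 1 - f 0) * i.
Proof.
move=> fD; have step i : f (i + 1) = f i + (f 1 - f 0).
  by have [/fD|/ltW/fD] := leP 0 i; rewrite add0r; [move->|move<-];
    rewrite [RHS]addrC subrK.
elim=> [|n IH|n IH]; first by rewrite mulr0 addr0.
  by rewrite -addn1 PoszD step IH; ring.
have := step (- n.+1%:Z); rewrite (_ : - n.+1%:Z + 1 = - n%:Z); last by lia.
by rewrite IH => /eqP; rewrite -subr_eq => /eqP <-; rewrite -addn1 PoszD; ring.
Qed.

Section Injective.
Variables (e : {multiplicative BZ Fam -> BZ Fam}) (e_inj : injective e).
Variables (f : bool -> int -> int) (r : bool -> bool).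
Hypothesis eE : forall i j q, e (i, j, fray q) = (f q i, f q j, fray (r q)).

(** In the chain ordered by 2 i + q, x < y amounts to x y = y with x <> y. The
    equation is preserved by e, and equality of the images is excluded by
    injectivity. *)
Lemma endo_increasing i j q q' : 2 * i + q%:Z < 2 * j + q'%:Z ->
  2 * f q i + (r q)%:Z < 2 * f q' j + (r q')%:Z.
Proof.
move=> lt_ij.
have neq : (i, i, @fray Fam q) <> (j, j, fray q').
  by move=> /triple_inj[ij _ qq]; lia.
have : (pt i i q * pt j j q')%g = (j, j, fray q') :> BZ Fam.
  rewrite mulBZE BZmulE; congr (_, _, fray _).
  - by move: q q' lt_ij {neq} => [] [] /=; lia.
  - by move: q q' lt_ij {neq} => [] [] /=; lia.
  - by move: q q' lt_ij {neq} => [] [] /=; repeat case: ifP => //; lia.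
move=> /(congr1 e); rewrite gmulfM !eE mulBZE BZmulE.
move=> /triple_inj[h1 _ h2].
have {}neq : f q i <> f q' j \/ r q <> r q'.
  case: (eqVneq (f q i) (f q' j)) => [ef|/eqP]; last by left.
  by right=> er; apply: neq; apply: e_inj; rewrite !eE ef er.
move: h1 h2 neq; case: (r q) (r q') => [] [] /=; repeat case: ifP; lia.
Qed.

(** The product (i + 1, i) (j, j) = (j + 1, j) inside level q transports the
    increment of f q at i to the one at any later j. *)
Lemma endo_affine q i : f q i = f q 0 + (f q 1 - f q 0) * i.
Proof.
move: i; apply: int_affine => i j ij.
have : (pt (i + 1) i q * pt j j q)%g = (j + 1, j, fray q) :> BZ Fam.
  rewrite mulBZE BZmulE; congr (_, _, fray _); try lia.
  by repeat case: ifP; lia.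
move=> /(congr1 e); rewrite gmulfM !eE mulBZE BZmulE => /triple_inj[h _ _].
have le_f : f q i <= f q j.
  move: ij; rewrite le_eqVlt => /orP[/eqP-> //|ij].
  by have := @endo_increasing i j q q; lia.
lia.
Qed.

(** The interlacing (i, i, [0)) < (i, i, [1)) < (i + 1, i + 1, [0)) keeps the
    affine function f true - f false between 0 and the slope of f false, so it
    is constant. *)
Lemma endo_common_slope : f true 1 - f true 0 = f false 1 - f false 0.
Proof.
have Af := endo_affine false; have At := endo_affine true.
set k := f false 1 - f false 0 in Af *; set l := f true 1 - f true 0 in At *.
have lo i : f false i <= f true i.
  by have := @endo_increasing i i false true; case: (r _) (r _) => [] []; lia.
have hi i : f true i <= f false (i + 1).
  have := @endo_increasing i (i + 1) true false.
  by case: (r _) (r _) => [] []; lia.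
have {lo hi}: forall i, 0 <= f true 0 - f false 0 + (l - k) * i <= k.
  by move=> i; have := lo i; have := hi i; rewrite (Af i) (Af (i + 1)) At; lia.
(* By b 0 the constant term lies in [0, k]; a nonzero integer slope would move
   the value at k + 1 out of that interval. *)
move=> b; have := b 0; have := b (k + 1); nia.
Qed.

(** Here k is f false 1 and p is f true 0, located by comparing (0, 0, [1)) with
    its neighbours (0, 0, [0)) and (1, 1, [0)) in the chain. The level of the
    image of (0, 0, [1)) decides whether p = 0 is possible. *)
Lemma endo_normal_form :
  e (0, 0, fray false) = (0, 0, fray false) ->
  (exists k p : nat,
    [/\ (1 <= k)%N, (p <= k - 1)%N & e = alpha k p :> (BZ Fam -> BZ Fam)]) \/
  (exists k p : nat,
    [/\ (2 <= k)%N, (1 <= p <= k - 1)%N & e = beta k p :> (BZ Fam -> BZ Fam)]).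
Proof.
rewrite eE => /triple_inj[f0 _ r0].
have Af := endo_affine false; have At := endo_affine true.
rewrite endo_common_slope f0 subr0 in Af At.
have := @endo_increasing 0 0 false true isT.
have := @endo_increasing 0 1 true false isT.
rewrite r0 f0.
(* The inequalities exclude negative values of f false 1 and f true 0. *)
case: (f false 1) Af At => k Af At; case: (f true 0) At => p At;
  case E: (r true) => lt1 lt2; try lia.
  left; exists k, p; split; try lia.
  apply/funext; apply: BZ_ind => i j [].
    by rewrite alphaE1 eE E !(At i) !(At j).
  by rewrite alphaE0 eE r0 (Af i) (Af j) !add0r.
right; exists k, p; split; try lia.
apply/funext; apply: BZ_ind => i j [].
  by rewrite betaE1 eE E !(At i) !(At j).
by rewrite betaE0 eE r0 (Af i) (Af j) !add0r.
Qed.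

End Injective.

Lemma at_at x : at_aut (at_aut x) = h_aut 1 x.
Proof.
elim/BZ_ind: x => i j q; rewrite !at_autE negbK /=.
by congr (_, _, _); case: q; lia.
Qed.

(** Both sides satisfy u (s + 1) = h_1 (u s); since h_1 is injective the
    recursion also runs backwards, to negative s. *)
Lemma at_even_power s x : aut_exp at_aut (2 * s) x = h_aut s x.
Proof.
have step n :
    aut_exp at_aut (2 * (n + 1)) x = h_aut 1 (aut_exp at_aut (2 * n) x).
  by rewrite -at_at -!aut_expS; congr (aut_exp _ _ x); lia.
have hD n : h_aut (n + 1) x = h_aut 1 (h_aut n x).
  by case: {step} x => [[i j] F] /=; rewrite !addrA.
elim: s => [|n IH|n IH].
- by case: x {step hD} => [[i j] F] /=; rewrite !addr0.
- have nE : n.+1%:Z = n%:Z + 1 by lia.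
  by rewrite nE step IH hD.
have sE : - n%:Z = - n.+1%:Z + 1 by lia.
by apply: (can_inj (autK (h_aut 1))); rewrite -step -hD -sE.
Qed.

Lemma at_odd_power s x : aut_exp at_aut (2 * s + 1) x = at_aut (h_aut s x).
Proof. by rewrite aut_expS at_even_power. Qed.

End Structure.

Theorem theorem3p4 (Fam : family2) (e : {multiplicative BZ Fam -> BZ Fam})
    (e_inj : injective e) :
  exists (e0 : {multiplicative BZ Fam -> BZ Fam}) (a : automorphism (BZ Fam)),
    [/\ injective e0,
        e0 (0, 0, fray false) = (0, 0, fray false)
      & e = e0 \; a :> (BZ Fam -> BZ Fam)] /\
    [/\ (forall s : int, e (0, 0, fray false) = (s, s, fray false) ->
           e = e0 \; aut_exp at_aut (2 * s) :> (BZ Fam -> BZ Fam) /\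
           e0 \; aut_exp at_aut (2 * s) = e0 \; h_aut s),
        (forall s : int, e (0, 0, fray false) = (s, s, fray true) ->
           e = e0 \; aut_exp at_aut (2 * s + 1) :> (BZ Fam -> BZ Fam) /\
           e0 \; aut_exp at_aut (2 * s + 1) = e0 \; h_aut s \; at_aut)
      & (exists k p : nat,
           [/\ (1 <= k)%N, (p <= k - 1)%N
             & e0 = alpha k p :> (BZ Fam -> BZ Fam)]) \/
        (exists k p : nat,
           [/\ (2 <= k)%N, (1 <= p <= k - 1)%N
             & e0 = beta k p :> (BZ Fam -> BZ Fam)])].
Proof.
have [f [r eE]] := endo_coordinates e.
set s := f false 0; set q := r false.
pose a : automorphism (BZ Fam) :=
  if q then aut_comp (h_aut s) at_aut else h_aut s.
have [e0 eaE] : exists e0 : {multiplicative BZ Fam -> BZ Fam},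
    forall x, e x = a (e0 x).
  by exists (untwist a e) => x; rewrite [RHS]autKV.
have e0_inj : injective e0.
  by move=> x y xy; apply: e_inj; rewrite !eaE xy.
have e0_fix : e0 (0, 0, fray false) = (0, 0, fray false).
  apply: (can_inj (autK a)); rewrite -eaE eE -/s -/q /a.
  by case: q {a eaE}; rewrite /= ?frayK /= ?addr0 ?add0r.
exists e0, a; split; [by split=> //; exact/funext|split].
- move=> t; rewrite eE -/s -/q => /triple_inj[st _ qE]; split; last first.
    by apply/funext => x; rewrite /= at_even_power.
  by apply/funext => x; rewrite eaE /= at_even_power /a qE st.
- move=> t; rewrite eE -/s -/q => /triple_inj[st _ qE]; split; last first.
    by apply/funext => x; rewrite /= at_odd_power.
  by apply/funext => x; rewrite eaE /= at_odd_power /a qE st.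
have [f0 [r0 e0E]] := endo_coordinates e0.
exact: (endo_normal_form (e := e0) e0_inj e0E e0_fix).
Qed.
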